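(* Let $X=\{x_i\}_{i=1}^n$ be a point cloud in a metric space $(\mathcal X,d)$, and let $\{y_i\}_{i=1}^n$ follow the model $$y_i=f^*(x_i)+\mu^*_{z_i^*},\qquad i=1,\dots,n,$$ with $f^*\in\mathcal F_\omega(\mathcal X)$, $\boldsymbol\mu^*\in\mathbb R^M$ and $\boldsymbol z^*=(z_i^* )\in[M]^n$. If the connectivity $\rho_{\min}=\rho_{\min}(X)$ of $X$ satisfies $$\omega(\rho_{\min})<\frac{1}{2M}\min_{k\ne\ell}|\mu_k^*-\mu_\ell^*|,$$ then the labels $\widehat{\boldsymbol z}$ produced by the optimization problem $$(\widehat f,\widehat{\boldsymbol\mu},\widehat{\boldsymbol z})=\operatorname*{argmin}_{f\in\mathcal F_\omega(\mathcal X),\ \boldsymbol\mu\in\mathbb R^M,\ \boldsymbol z\in[M]^n}\ \frac1n\sum_{i=1}^n\bigl(y_i-\mu_{z_i}-f(x_i)\bigr)^2$$ have zero misclassification error relative to $\boldsymbol z^*$.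
   Context: $[M]=\{1,\dots,M\}$. For a modulus of continuity $\omega:[0,\infty)\to[0,\infty)$, $\mathcal F_\omega(\mathcal X)$ is the class of real-valued, uniformly continuous functions on $(\mathcal X,d)$ with modulus of continuity $\omega$, that is, $$\mathcal F_\omega(\mathcal X)=\{f:\mathcal X\to\mathbb R:\ |f(x)-f(x')|\le\omega(d(x,x'))\ \ \forall x,x'\in\mathcal X\}.$$ The $\rho$-neighbor graph $G_\rho(X)$ of the point cloud $X=\{x_i\}_{i=1}^n$ has vertex set $[n]$ and edge set $\{(i,j)\in[n]^2:i\ne j,\ d(x_i,x_j)\le\rho\}$. The connectivity of $X$ is $\rho_{\min}(X)=\inf\{\rho>0: G_\rho(X)\text{ is connected}\}$. The misclassification error between two label vectors in $[M]^n$ is, as usual, the fraction of indices at which they disagree, minimized over permutations of the labels $[M]$ of one of them.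
   Formalization: The formal theorem additionally assumes that every label of [M] occurs among the true labels z*; without this an unused label can split a true cluster at objective value 0, so an argmin may have positive misclassification error. *)

(* Defs.v *)
From HB Require Import structures.
From mathcomp Require Import all_boot all_order all_algebra all_fingroup.
From mathcomp Require Import all_classical all_reals all_analysis.

Set Implicit Arguments.
Unset Strict Implicit.
Unset Printing Implicit Defensive.

Import Order.TTheory GRing.Theory Num.Theory.
Import numFieldNormedType.Exports.
Local Open Scope classical_set_scope.
Local Open Scope ring_scope.

(* Only the restriction of [omega] to the nonnegative half-line is
   constrained. *)
Definition modulus_of_continuity (R : realType) (omega : R -> R) : Prop :=
  [/\ forall t, 0 <= t -> 0 <= omega t,
      forall s t, 0 <= s -> s <= t -> omega s <= omega t,
      omega 0 = 0
    & omega t @[t --> 0^'+] --> 0].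

Definition Fclass (R : realType) (X : metricType R) (omega : R -> R)
    : set (X -> R) :=
  [set f | forall u v : X, `|f u - f v| <= omega (mdist u v)].
Arguments Fclass {R} X omega.

Definition nbr_graph (R : realType) (X : metricType R) (n : nat)
    (x : 'I_n -> X) (rho : R) : rel 'I_n :=
  [rel i j | (i != j) && (mdist (x i) (x j) <= rho)].

Definition graph_connected (T : finType) (e : rel T) : Prop :=
  forall i j : T, connect e i j.

Definition rho_min (R : realType) (X : metricType R) (n : nat)
    (x : 'I_n -> X) : R :=
  inf [set rho : R | 0 < rho /\ graph_connected (nbr_graph x rho)].

(* Extended-real valued: the minimum is over the empty set when M = 1. *)
Definition min_gap (R : realType) (M : nat) (mu : 'rV[R]_M) : \bar R :=
  \big[Order.min/+oo%E]_(kl : 'I_M * 'I_M | kl.1 != kl.2)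
    `|mu 0 kl.1 - mu 0 kl.2|%:E.

Definition objective (R : realType) (X : metricType R) (n M : nat)
    (x : 'I_n -> X) (y : 'rV[R]_n)
    (f : X -> R) (mu : 'rV[R]_M) (z : {ffun 'I_n -> 'I_M}) : R :=
  n%:R^-1 * \sum_(i < n) (y 0 i - mu 0 (z i) - f (x i)) ^+ 2.

Definition is_argmin (R : realType) (X : metricType R) (n M : nat)
    (omega : R -> R) (x : 'I_n -> X) (y : 'rV[R]_n)
    (f : X -> R) (mu : 'rV[R]_M) (z : {ffun 'I_n -> 'I_M}) : Prop :=
  Fclass X omega f /\
  forall (g : X -> R) (nu : 'rV[R]_M) (w : {ffun 'I_n -> 'I_M}),
    Fclass X omega g -> objective x y f mu z <= objective x y g nu w.

Definition disagreement (R : realType) (n M : nat)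
    (z w : {ffun 'I_n -> 'I_M}) : R :=
  #|[set i | z i != w i]%SET|%:R / n%:R.

(* The neutral element of the iterated minimum is the value at the identity
   permutation, which is one of the values minimized over. *)
Definition misclassification (R : realType) (n M : nat)
    (z w : {ffun 'I_n -> 'I_M}) : R :=
  \big[Num.min/disagreement R z w]_(s : {perm 'I_M})
    disagreement R z [ffun i => s (w i)].

(* Main.v *)
(* The true parameters attain objective 0, so the estimator interpolates the
   data, and [h i = muhat_(zhat i) - mustar_(zstar i)] equals
   [fstar (x i) - fhat (x i)].  Hence [h] moves by at most [2 omega(rho_min)]
   along an edge of the neighbor graph at the scale [rho_min], which is
   connected.  Two points with the same estimated label have values of [h]
   that are equal or more than [2 M omega(rho_min)] apart, so at most [M]
   distinct values fit in an interval of that length; a chain with small steps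
   needs [M + 1] distinct values to cross it, so all of [h] lies in such an
   interval.  Then equal estimated labels force equal true labels, and as all
   [M] true labels occur, the correspondence is a permutation. *)
Require Import Defs.
From HB Require Import structures.
From mathcomp Require Import all_boot all_order all_algebra all_fingroup.
From mathcomp Require Import all_classical all_reals all_analysis.
From mathcomp Require Import lra.

Set Implicit Arguments.
Unset Strict Implicit.
Unset Printing Implicit Defensive.

Import Order.TTheory GRing.Theory Num.Theory.
Import numFieldNormedType.Exports.
Local Open Scope classical_set_scope.
Local Open Scope ring_scope.

Lemma connect_crossing (T : finType) (e : rel T) (a : pred T) (i j : T) :
  connect e i j -> a i -> ~~ a j -> exists u v, [/\ e u v, a u & ~~ a v].
Proof.
move=> /connectP[p + ->]; elim: p i => [|k p IHp] i /=; first by move=> _ ->.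
move=> /andP[eik pathp] ai naj.
by have [ak|nak] := boolP (a k); [exact: IHp pathp ak naj | exists i, k].
Qed.

(** Pigeonhole: a larger spread would put a value of [h] in each of [M + 1] disjoint windows of
    length [eps], and two of these points would share a label [c]. *)
Lemma connected_spread_le (R : realFieldType) (T : finType) (e : rel T)
    (M : nat) (h : T -> R) (c : T -> 'I_M) (eps : R) :
    graph_connected e -> 0 < eps ->
    (forall u v, e u v -> `|h u - h v| <= eps) ->
    (forall u v, c u = c v -> `|h u - h v| <= M%:R * eps -> h u = h v) ->
  forall u v, `|h u - h v| <= M%:R * eps.
Proof.
move=> conn_e eps_gt0 step sep u v.
have [m _ hm] := arg_minP h (erefl : predT u).
suff up w : h w <= h m + M%:R * eps.
  have := (hm u isT, hm v isT, up u, up v) => -[[[? ?] ?] ?].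
  by rewrite ler_norml; apply/andP; split; lra.
rewrite leNgt; apply/negP => hw.
(* A path from the minimizer [m] to [w] must leave the sublevel set of height [h m + k * eps]; the
   inner end of the leaving edge is within one step [eps] of that height. *)
have bin (k : 'I_M.+1) :
    {j | h m + k%:R * eps - eps < h j <= h m + k%:R * eps}.
  have keps : k%:R * eps <= M%:R * eps.
    by rewrite ler_pM2r// ler_nat -ltnS.
  apply: cid; have [|||i [j [eij]]] :=
    @connect_crossing _ e (fun i => h i <= h m + k%:R * eps) m w.
  - exact: conn_e.
  - by rewrite lerDl mulr_ge0// ltW.
  - by rewrite -ltNge; lra.
  rewrite -ltNge => hi hj; exists i; rewrite hi andbT.
  by have := step _ _ eij; rewrite ler_norml => /andP[? ?]; lra.
pose b k := sval (bin k).
have bP (k : 'I_M.+1) : h m + k%:R * eps - eps < h (b k) <= h m + k%:R * eps.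
  exact: svalP (bin k).
have h_mono (k l : 'I_M.+1) : (k < l)%N -> h (b k) < h (b l).
  move=> kl; have /andP[lb _] := bP l; have /andP[_ ub] := bP k.
  apply: le_lt_trans ub (le_lt_trans _ lb).
  have : k.+1%:R * eps <= l%:R * eps by rewrite ler_pM2r// ler_nat.
  by rewrite -natr1 mulrDl mul1r; lra.
have hb_rng k : h m <= h (b k) <= h m + M%:R * eps.
  have /andP[_ ub] := bP k; rewrite (hm _ isT)/=.
  by apply: le_trans ub _; rewrite lerD2l ler_pM2r// ler_nat -ltnS.
have cb_inj : injective (c \o b).
  move=> k l /= ckl.
  have hkl : h (b k) = h (b l).
    apply: sep => //; have := (hb_rng k, hb_rng l).
    by rewrite ler_norml => -[/andP[? ?] /andP[? ?]]; lra.
  apply: val_inj; have [/h_mono||//] := ltngtP (val k) (val l).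
    by rewrite hkl ltxx.
  by move/h_mono; rewrite hkl ltxx.
by have := leq_card _ cb_inj; rewrite !card_ord ltnn.
Qed.

Lemma finite_gap_above (R : realFieldType) (I : finType) (F : I -> R) (a : R) :
  exists2 eps, 0 < eps & forall i, a < F i -> a + eps <= F i.
Proof.
(* The default 1 keeps the minimum positive when no value exceeds [a]. *)
exists (\big[Num.min/1]_(i | a < F i) (F i - a)).
  by apply: lt_bigmin => // i; rewrite subr_gt0.
by move=> i ai; rewrite -lerBrDl; apply: bigmin_le_cond.
Qed.

Lemma graph_connected_sub (T : finType) (e e' : rel T) :
  subrel e e' -> graph_connected e -> graph_connected e'.
Proof.
move=> sub conn_e i j; apply: connect_sub (conn_e i j).
by move=> u v /sub; apply: connect1.
Qed.

Lemma connected_scale_exists (R : realType) (X : metricType R) (n : nat)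
    (x : 'I_n -> X) :
  [set rho : R | 0 < rho /\ graph_connected (nbr_graph x rho)] !=set0.
Proof.
(* The default 1 makes the scale positive even if all distances vanish. *)
pose D := \big[Num.max/1]_(ij : 'I_n * 'I_n) mdist (x ij.1) (x ij.2).
exists D; split; first by apply: lt_le_trans ltr01 _; exact: bigmax_ge_id.
move=> i j; have [->|neq_ij] := eqVneq i j; first exact: connect0.
apply: connect1; apply/andP; split => //.
exact: (le_bigmax _ (fun ij => mdist (x ij.1) (x ij.2)) (i, j)).
Qed.

(* Only finitely many distances occur, so the infimum is attained, except
   possibly when it is 0, where the graph at scale 0 is still connected. *)
Lemma nbr_graph_rho_min_connected (R : realType) (X : metricType R) (n : nat)
    (x : 'I_n -> X) :
  graph_connected (nbr_graph x (rho_min x)).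
Proof.
have [eps eps_gt0 gap] := finite_gap_above
  (fun ij : 'I_n * 'I_n => mdist (x ij.1) (x ij.2)) (rho_min x).
have [|rho [_ conn_rho] rho_lt] := inf_lt (x := rho_min x + eps)
  (connected_scale_exists x); first by rewrite ltrDl.
(* No distance lies strictly between [rho_min x] and [rho_min x + eps], so edges at scale [rho] are
   already edges at scale [rho_min x]. *)
apply: graph_connected_sub conn_rho => i j /andP[neq_ij d_le].
apply/andP; split=> //.
rewrite leNgt; apply/negP => /(gap (i, j))/= d_ge.
by have := lt_le_trans rho_lt d_ge; rewrite ltNge d_le.
Qed.

Lemma min_gap_le (R : realType) (M : nat) (mu : 'rV[R]_M) (k l : 'I_M) :
  k != l -> (min_gap mu <= `|mu 0 k - mu 0 l|%:E)%E.
Proof.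
move=> neq_kl; exact: (@bigmin_le_cond _ _ _ _ (k, l) _
  (fun kl : 'I_M * 'I_M => `|mu 0 kl.1 - mu 0 kl.2|%:E)).
Qed.

(* A real number is interposed, strictly on the right, so that the case
   [M = 1], where [min_gap mu] is infinite, needs no separate treatment. *)
Lemma lt_min_gapP (R : realType) (M : nat) (mu : 'rV[R]_M) (t : R) :
    (0 < M)%N -> 0 <= t ->
    (t%:E < ((2 * M%:R)^-1)%:E * min_gap mu)%E ->
  exists eps, [/\ 0 < eps, 2 * t <= eps &
    forall k l : 'I_M, k != l -> M%:R * eps < `|mu 0 k - mu 0 l|].
Proof.
move=> M_gt0 t_ge0; have M_gt0' : 0 < M%:R :> R by rewrite ltr0n.
have := @min_gap_le _ _ mu; case: (min_gap mu) => [r| |] le_r.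
- rewrite -EFinM lte_fin ltr_pdivlMl ?mulr_gt0// => lt_r.
  exists ((2 * t + r / M%:R) / 2).
  have : 2 * t < r / M%:R by rewrite ltr_pdivlMr//; lra.
  move=> lt_rM; split; [lra|lra|] => k l /le_r; rewrite lee_fin.
  apply: lt_le_trans; rewrite mulrC -ltr_pdivlMr//; lra.
- move=> _; exists (2 * t + 1); split; [lra|lra|] => k l /le_r.
  by rewrite leye_eq.
- by rewrite gt0_muleNy// lte_fin invr_gt0 mulr_gt0.
Qed.

Lemma argmin_interpolates (R : realType) (X : metricType R) (n M : nat)
    (omega : R -> R) (x : 'I_n -> X) (y : 'rV[R]_n)
    (f g : X -> R) (mu nu : 'rV[R]_M) (z w : {ffun 'I_n -> 'I_M}) :
    (0 < n)%N -> Fclass X omega g ->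
    (forall i, y 0 i = g (x i) + nu 0 (w i)) ->
    is_argmin omega x y f mu z ->
  forall i, y 0 i = f (x i) + mu 0 (z i).
Proof.
move=> n_gt0 gF model [_ /(_ g nu w gF)].
rewrite /objective ler_pM2l ?invr_gt0 ?ltr0n// => obj_le i.
have obj0 : \sum_(i < n) (y 0 i - nu 0 (w i) - g (x i)) ^+ 2 = 0.
  by apply: big1 => j _; rewrite model addrK subrr expr0n.
rewrite obj0 in obj_le.
have sum0 : \sum_(i < n) (y 0 i - mu 0 (z i) - f (x i)) ^+ 2 = 0.
  apply/eqP; rewrite eq_le obj_le/=.
  by apply: sumr_ge0 => j _; exact: sqr_ge0.
have /eqP := psumr_eq0P (fun j _ => sqr_ge0 _) sum0 (i := i) isT.
by rewrite sqrf_eq0 => /eqP; lra.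
Qed.

Lemma misclassification_perm (R : realType) (n M : nat)
    (z w : {ffun 'I_n -> 'I_M}) (s : {perm 'I_M}) :
  (forall i, z i = s (w i)) -> misclassification R z w = 0.
Proof.
move=> zsw; apply/eqP; rewrite eq_le; apply/andP; split.
  apply: (bigmin_inf s) => //; rewrite /disagreement.
  rewrite (_ : [set i | _]%SET = finset.set0) ?cards0 ?mul0r//.
  by apply/setP => i; rewrite !inE ffunE zsw eqxx.
by apply: le_bigmin => [|t _]; rewrite divr_ge0.
Qed.

(** With one representative [r k] per value [k] of [w], the map [z \o r] is an injective self-map of
    a finite set, hence a permutation. *)
Lemma perm_of_refinement (I : finType) (M : nat)
    (z w : I -> 'I_M) :
    (forall k, exists i, w i = k) -> (forall i j, z i = z j -> w i = w j) ->
  exists s : {perm 'I_M}, forall i, z i = s (w i).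
Proof.
move=> w_onto zw; pose r k := sval (cid (w_onto k)).
have rK k : w (r k) = k by exact: svalP (cid (w_onto k)).
have zr_inj : injective (z \o r) by move=> k l /zw; rewrite !rK.
exists (perm zr_inj) => i; rewrite permE /=.
have /codomP[k zi] := injF_onto zr_inj (z i).
by rewrite zi (zw _ _ zi) rK.
Qed.

Theorem theorem1 (R : realType) (X : metricType R) (n M : nat)
    (omega : R -> R) (x : 'I_n -> X) (y : 'rV[R]_n)
    (fstar : X -> R) (mustar : 'rV[R]_M) (zstar : {ffun 'I_n -> 'I_M})
    (fhat : X -> R) (muhat : 'rV[R]_M) (zhat : {ffun 'I_n -> 'I_M})
    (n_gt0 : (0 < n)%N)
    (omega_modulus : modulus_of_continuity omega)
    (fstar_in : Fclass X omega fstar)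
    (model : forall i : 'I_n, y 0 i = fstar (x i) + mustar 0 (zstar i))
    (zstar_onto : forall k : 'I_M, exists i : 'I_n, zstar i = k)
    (separation : ((omega (rho_min x))%:E
                   < ((2 * M%:R)^-1)%:E * min_gap mustar)%E)
    (argmin_hat : is_argmin omega x y fhat muhat zhat) :
  misclassification R zhat zstar = 0.
Proof.
have M_gt0 : (0 < M)%N.
  by apply: leq_ltn_trans (ltn_ord (zstar (Ordinal n_gt0))).
have [omega_ge0 omega_mono _ _] := omega_modulus.
have rho_ge0 : 0 <= rho_min x.
  apply: lb_le_inf; first exact: connected_scale_exists.
  by move=> rho [/ltW].
have [eps [eps_gt0 le_eps gap]] :=
  lt_min_gapP M_gt0 (omega_ge0 _ rho_ge0) separation.
have fit := argmin_interpolates n_gt0 fstar_in model argmin_hat.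
have [fhat_in _] := argmin_hat.
pose h i := muhat 0 (zhat i) - mustar 0 (zstar i).
have step i j : nbr_graph x (rho_min x) i j -> `|h i - h j| <= eps.
  move=> /andP[_ /(omega_mono _ _ (mdist_ge0 _ _)) d_le].
  have := (fhat_in (x i) (x j), fstar_in (x i) (x j), fit i, fit j).
  rewrite /h !model !ler_norml => -[[[/andP[? ?] /andP[? ?]] ?] ?].
  by apply/andP; split; lra.
have label_inj i j : zhat i = zhat j -> `|h i - h j| <= M%:R * eps ->
    zstar i = zstar j.
  (* The [muhat] terms cancel, leaving a difference of two entries of [mustar], to which [gap]
     applies. *)
  move=> zij; rewrite /h zij opprB [X in `|X|]addrC addrA subrK => hij.
  by apply/esym/eqP; apply: contraT => /gap; rewrite ltNge hij.
have spread := @connected_spread_le _ _ _ _ h zhat eps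
  (@nbr_graph_rho_min_connected _ _ _ x) eps_gt0 step.
have [|s zs] := @perm_of_refinement _ _ zhat zstar zstar_onto.
  (* [label_inj] serves twice: locally, to supply the dichotomy that [spread] requires, then for all
     pairs through the resulting global bound. *)
  move=> i j zij; apply: (label_inj i j zij); apply: spread => u v zuv huv.
  by rewrite /h zuv (label_inj u v).
exact: misclassification_perm zs.
Qed.
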